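(* Let $\sigma>0$, $\alpha\in(1,2)$, $q=\alpha/(\alpha-1)$, and for $\Delta>0$ write $\varepsilon=\Delta/\sigma$. Let $$C(\alpha)=\Bigl(\tfrac{\alpha-1}{\alpha}\Bigr)^{\alpha/2}\Bigl(\tfrac{2-\alpha}{\alpha-1}\Bigr)^{(2-\alpha)/2},\qquad K(\alpha)=\frac{\alpha-1}{\alpha\,(\alpha\,C(\alpha))^{1/(\alpha-1)}}.$$ (i) For every $\Delta>0$ put $$M_\alpha(\Delta)=\sup_{P\in\mathcal C_0}E_P[|X-\Delta|^\alpha],\qquad r_B(\Delta)=\frac{\alpha-1}{\alpha}\,\frac{\Delta^q}{\bigl(\alpha\,C(\alpha)\,M_\alpha(\Delta)\bigr)^{1/(\alpha-1)}} .$$ There are a scale $\lambda>0$ and a non-decreasing $\psi:\mathbb R\to\mathbb R$ satisfying $$-\log\bigl(1-x/\lambda+C(\alpha)|x/\lambda|^\alpha\bigr)\le\psi(x)\le\log\bigl(1+x/\lambda+C(\alpha)|x/\lambda|^\alpha\bigr)\qquad\text{for all }x\in\mathbb R$$ such that $$\sup_{P\in\mathcal C_0}\log E_P[e^{\psi(X-\Delta)}]\le-r_B(\Delta)\quad\text{and}\quad\sup_{P\in\mathcal C_0}\log E_P[e^{-\psi(X+\Delta)}]\le-r_B(\Delta);$$ in particular $r_M(\Delta)\ge r_B(\Delta)$. (ii) Let $s^\star=\sqrt{\alpha(2-\alpha)}$. For every sufficiently small $\varepsilon>0$ one can choose $m=m(\varepsilon)\in(0,\tfrac12)$ such that, with $p_\pm=(1\pm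 s^\star)m$, $p_0=1-2m$, $a=\Delta/(p_+-p_-)$ and $$P^\star_{\pm\Delta}=p_-\,\delta_{\mp a}+p_0\,\delta_0+p_+\,\delta_{\pm a},$$ the moment constraint binds, $E_{P^\star_\Delta}[|X-\Delta|^\alpha]=\sigma^\alpha$, so that $P^\star_{\pm\Delta}\in\mathcal C_{\pm\Delta}$; moreover $p_0+2\sqrt{p_+p_-}=1-K(\alpha)\varepsilon^q+o(\varepsilon^q)$ and $$r(\Delta)\;\le\;-\log\bigl(p_0+2\sqrt{p_+p_-}\bigr)\;=\;K(\alpha)\,\varepsilon^q+o(\varepsilon^q)\qquad(\varepsilon\downarrow0).$$
   Context: For $\mu\in\mathbb R$, $\mathcal C_\mu$ is the set of Borel probability measures $P$ on $\mathbb R$ with $\int x\,dP=\mu$ and $\int|x-\mu|^\alpha\,dP\le\sigma^\alpha$. $r(\Delta):=-\log\sup\{\rho(P_-,P_+): P_-\in\mathcal C_{-\Delta},\,P_+\in\mathcal C_{\Delta}\}$, where $\rho(P_-,P_+)=\int\sqrt{dP_-\,dP_+}$ is the Hellinger affinity (computed with densities with respect to any common dominating measure). $r_M(\Delta)$ is the supremum of all $r\in\mathbb R$ for which there exists a non-decreasing $\psi:\mathbb R\to\mathbb R$ with $\sup_{P\in\mathcal C_0}\log E_P[e^{\psi(X-\Delta)}]+r\le0$ and $\sup_{P\in\mathcal C_0}\log E_P[e^{-\psi(X+\Delta)}]+r\le0$. *)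

(* Defs.v *)
From HB Require Import structures.
From mathcomp Require Import all_boot all_order all_algebra.
From mathcomp Require Import all_classical all_reals all_analysis.

Set Implicit Arguments.
Unset Strict Implicit.
Unset Printing Implicit Defensive.

Import Order.TTheory GRing.Theory Num.Theory.
Import numFieldNormedType.Exports.

Local Open Scope classical_set_scope.
Local Open Scope ring_scope.
Local Open Scope charge_scope.

Notation borel_prob R := (probability (measurableTypeR R) R).

(* Logarithms of expectations and of affinities are taken in \bar R with lne,
   for which lne 0 = -oo and lne +oo = +oo. *)

Section moment_class.
Context {R : realType}.
Implicit Types (alpha sigma mu : R).

Definition moment_class alpha sigma mu : set (borel_prob R) :=
  [set P | [/\ P.-integrable [set: R] EFin,
               (\int[P]_x x%:E = mu%:E)%E
             & (\int[P]_x (`|x - mu| `^ alpha)%:E <= (sigma `^ alpha)%:E)%E]].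

End moment_class.

Section dominating_measure.
Context {R : realType} (P Q : borel_prob R).

Definition sum_measure : set (measurableTypeR R) -> \bar R := measure_add P Q.

HB.instance Definition _ := Measure.on sum_measure.

Lemma sum_measure_fin : fin_num_fun sum_measure.
Proof.
by move=> A mA; rewrite /sum_measure measure_addE fin_numD !fin_num_measure.
Qed.

HB.instance Definition _ :=
  Measure_isFinite.Build _ _ _ sum_measure sum_measure_fin.

(* P + Q serves as the common dominating measure; the affinity does not depend
   on this choice. *)
Definition hellinger_affinity : \bar R :=
  (\int[sum_measure]_x
     (Num.sqrt (fine ('d (charge_of_finite_measure P) '/d sum_measure x)
              * fine ('d (charge_of_finite_measure Q) '/d sum_measure x)))%:E)%E.

End dominating_measure.

Section rates.
Context {R : realType}.
Implicit Types (alpha sigma Delta : R).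

Definition hellinger_rate alpha sigma Delta : \bar R :=
  (- lne (ereal_sup [set hellinger_affinity Pm Pp
                    | Pm in moment_class alpha sigma (- Delta)
                    & Pp in moment_class alpha sigma Delta]))%E.

Definition sup_log_mean_exp alpha sigma (f : R -> R) : \bar R :=
  ereal_sup [set lne (\int[P]_x (expR (f x))%:E)%E
            | P in moment_class alpha sigma 0].

Definition monotone_rate alpha sigma Delta : \bar R :=
  ereal_sup [set r%:E | r in
    [set r | exists psi : R -> R,
      [/\ {homo psi : x y / x <= y},
          (sup_log_mean_exp alpha sigma (fun x => psi (x - Delta)%R) + r%:E
             <= 0)%E
        & (sup_log_mean_exp alpha sigma (fun x => (- psi (x + Delta))%R) + r%:E
             <= 0)%E]]].

Definition conj_exp alpha : R := alpha / (alpha - 1).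

Definition Cconst alpha : R :=
  ((alpha - 1) / alpha) `^ (alpha / 2)
  * ((2 - alpha) / (alpha - 1)) `^ ((2 - alpha) / 2).

Definition Kconst alpha : R :=
  (alpha - 1) / (alpha * (alpha * Cconst alpha) `^ (alpha - 1)^-1).

Definition Msup alpha sigma Delta : \bar R :=
  ereal_sup [set (\int[P]_x (`|x - Delta| `^ alpha)%:E)%E
            | P in moment_class alpha sigma 0].

(* Meaningful when Msup is finite. *)
Definition rB alpha sigma Delta : R :=
  (alpha - 1) / alpha
  * (Delta `^ conj_exp alpha
     / (alpha * Cconst alpha * fine (Msup alpha sigma Delta))
         `^ (alpha - 1)^-1).

Definition s_star alpha : R := Num.sqrt (alpha * (2 - alpha)).
Definition p_plus alpha (m : R) : R := (1 + s_star alpha) * m.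
Definition p_minus alpha (m : R) : R := (1 - s_star alpha) * m.
Definition p_zero (m : R) : R := 1 - 2 * m.
Definition atom alpha (m : R) Delta : R :=
  Delta / (p_plus alpha m - p_minus alpha m).

Definition three_point (pm p0 pp a : R) : set (measurableTypeR R) -> \bar R :=
  let d (x : measurableTypeR R) := @dirac _ _ x R in
  fun A => (pm%:E * d (- a)%R A + p0%:E * d 0%R A + pp%:E * d a A)%E.

(* P*_Delta is obtained at a = atom alpha m Delta and P*_{-Delta} at - a. *)
Definition P_star_law alpha (m a : R) : set (measurableTypeR R) -> \bar R :=
  three_point (p_minus alpha m) (p_zero m) (p_plus alpha m) a.

Definition star_affinity alpha (m : R) : R :=
  p_zero m + 2 * Num.sqrt (p_plus alpha m * p_minus alpha m).

End rates.

(* Main.v *)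
(* (i) The constant C = C(alpha) is the least one such that
   g(y) = 1 + y + C |y|^alpha satisfies g(y) g(-y) >= 1 for all y, so that
   -ln g(-y) <= ln g(y). Freezing ln g to the left of the minimizer of g yields
   a non-decreasing psi between these two functions, and
   E e^{psi((X - Delta) / lambda)} <= E g((X - Delta) / lambda)
     <= 1 - Delta / lambda + C M / lambda^alpha,
   whose minimum over lambda is 1 - r_B. The other sign follows by reflecting P.

   (ii) For the three-point law, binding of the moment constraint reads
   F(m) = (2 s)^alpha t^(alpha - 1) where m = t eps^q and F(m) -> 2 as m -> 0.
   As F lies between two positive constants, the intermediate value theorem
   gives a solution t in a fixed compact subset of ]0, +oo[; hence m -> 0 and t
   converges. The affinity is 1 - 2 (2 - alpha) m, and the Hellinger integral is
   at least its restriction to the three atoms. *)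
Require Import Defs.
From HB Require Import structures.
From mathcomp Require Import all_boot all_order all_algebra.
From mathcomp Require Import all_classical all_reals all_analysis.
From mathcomp Require Import measurable_realfun ring lra.

Import Order.TTheory GRing.Theory Num.Theory.
Import numFieldNormedType.Exports.

Local Open Scope classical_set_scope.
Local Open Scope ring_scope.

Set Implicit Arguments.
Unset Strict Implicit.
Unset Printing Implicit Defensive.

(** * The envelope g(y) = 1 + y + C |y|^alpha and the truncated influence function *)

Section catoni_bound.
Context {R : realType}.
Implicit Types alpha : R.

Lemma Cconst_gt0 alpha : 1 < alpha -> alpha < 2 -> 0 < Cconst alpha.
Proof.
move=> a1 a2; have a0 : 0 < alpha by lra.
by rewrite mulr_gt0// powR_gt0// divr_gt0// subr_gt0.
Qed.

Lemma ln_Cconst alpha : 1 < alpha -> alpha < 2 ->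
  ln (Cconst alpha) = (alpha * (ln (alpha - 1) - ln alpha)
    + (2 - alpha) * (ln (2 - alpha) - ln (alpha - 1))) / 2.
Proof.
move=> a1 a2; have a0 : 0 < alpha by lra.
have ap0 : 0 < alpha - 1 by lra.
have am0 : 0 < 2 - alpha by lra.
rewrite lnM ?posrE ?powR_gt0 ?divr_gt0// !ln_powR.
by rewrite !ln_div ?posrE//; field.
Qed.

(** Young's inequality multiplied by alpha: the convex function t^alpha lies above its tangent at w.
    It stands in for differentiation in the study of g. *)
Lemma powR_young alpha (v w : R) : 1 < alpha -> 0 <= w ->
  alpha * w `^ (alpha - 1) * `|v| <= `|v| `^ alpha + (alpha - 1) * w `^ alpha.
Proof.
move=> a1 w0; have a0 : 0 < alpha by lra.
have ap0 : 0 < alpha - 1 by lra.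
have an0 := lt0r_neq0 a0; have apn0 := lt0r_neq0 ap0.
have := @conjugate_powR R `|v| (w `^ (alpha - 1)) alpha (alpha / (alpha - 1)).
rewrite normr_ge0 powR_ge0 a0 divr_gt0// => /(_ isT isT isT isT) H.
have {}H : `|v| * w `^ (alpha - 1) <= `|v| `^ alpha / alpha +
    w `^ (alpha - 1) `^ (alpha / (alpha - 1)) / (alpha / (alpha - 1)).
  by apply: H; field; rewrite an0 apn0.
move: H; rewrite -powRrM mulrCA divff// mulr1 -(ler_pM2l a0) => H.
rewrite -mulrA (mulrC _ `|v|) (le_trans H)// le_eqVlt; apply/orP; left.
by apply/eqP; field; rewrite an0 apn0.
Qed.

(* Weighted AM-GM with weights 2(alpha-1)/alpha and (2-alpha)/alpha, written as
   [1 + ln X <= X]; [Cconst] is exactly the constant that makes it sharp. *)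
Lemma Cconst_amgm alpha (t : R) : 1 < alpha -> alpha < 2 -> 0 <= t ->
  t ^+ 2 <= 2 * (Cconst alpha * t `^ alpha) + (Cconst alpha * t `^ alpha) ^+ 2.
Proof.
move=> a1 a2; have a0 : 0 < alpha by lra.
have ap0 : 0 < alpha - 1 by lra.
have am0 : 0 < 2 - alpha by lra.
have an0 := lt0r_neq0 a0.
rewrite le_eqVlt => /predU1P[<-|t0]; first by rewrite powR0// mulr0; lra.
have C0 := Cconst_gt0 a1 a2; set C := Cconst alpha in C0 *.
(* With u = C t^alpha, [X] and [Y] are 2u / t^2 and u^2 / t^2 divided by their weights, so the goal
   says that their weighted mean is at least 1. *)
pose X := C * t `^ alpha * (alpha / (alpha - 1)) / t ^+ 2.
pose Y := (C * t `^ alpha) ^+ 2 * (alpha / (2 - alpha)) / t ^+ 2.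
have u0 : 0 < C * t `^ alpha by rewrite mulr_gt0// powR_gt0.
have t20 : 0 < t ^+ 2 by rewrite exprn_gt0.
have X0 : 0 < X by rewrite /X divr_gt0// mulr_gt0// divr_gt0.
have Y0 : 0 < Y by rewrite /Y divr_gt0// mulr_gt0 ?divr_gt0// exprn_gt0.
have ln_le (z : R) : 0 < z -> 1 + ln z <= z.
  by move=> z0; rewrite -[leRHS]lnK ?posrE// expR_ge1Dx.
have eX := ln_le _ X0; have eY := ln_le _ Y0.
have lnq (a b c d : R) : 0 < a -> 0 < b -> 0 < c -> 0 < d ->
    ln (a * (b / c) / d) = ln a + (ln b - ln c) - ln d.
  move=> *; have bc0 : 0 < b / c by rewrite divr_gt0.
  by rewrite -[ln b - _]ln_div ?posrE// -lnM ?posrE// -ln_div ?posrE// mulr_gt0.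
have lnu : ln (C * t `^ alpha) = ln C + alpha * ln t.
  by rewrite lnM ?posrE ?powR_gt0// ln_powR.
have lnX : ln X = ln C + alpha * ln t + (ln alpha - ln (alpha - 1)) - ln t *+ 2.
  by rewrite -lnu -lnXn//; exact: lnq u0 a0 ap0 t20.
have lnY : ln Y = (ln C + alpha * ln t) *+ 2 + (ln alpha - ln (2 - alpha))
    - ln t *+ 2.
  rewrite -lnu -!lnXn//; apply: lnq => //; exact: exprn_gt0.
(* The terms in ln t cancel, and the remaining ones are 2 ln C minus its explicit value. *)
have H0 : 2 * (alpha - 1) * ln X + (2 - alpha) * ln Y = 0.
  rewrite lnX lnY ln_Cconst//.
  by field.
have H1 : alpha <= 2 * (alpha - 1) * X + (2 - alpha) * Y by nra.
have H2 : alpha * t ^+ 2 <= (2 * (alpha - 1) * X + (2 - alpha) * Y) * t ^+ 2.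
  by rewrite ler_pM2r.
rewrite -(ler_pM2l a0) (le_trans H2)// le_eqVlt; apply/orP; left; apply/eqP.
by rewrite /X /Y; field; rewrite !lt0r_neq0.
Qed.

Definition catoni_exp alpha (y : R) : R := 1 + y + Cconst alpha * `|y| `^ alpha.

(** The negative root of g'(y) = 1 - alpha C |y|^(alpha - 1). *)
Definition catoni_argmin alpha : R :=
  - (alpha * Cconst alpha) `^ (- (alpha - 1)^-1).

Lemma catoni_argminE alpha : 1 < alpha -> alpha < 2 ->
  alpha * Cconst alpha *
    ((alpha * Cconst alpha) `^ (- (alpha - 1)^-1)) `^ (alpha - 1) = 1.
Proof.
move=> a1 a2; have C0 := Cconst_gt0 a1 a2.
have aC0 : 0 < alpha * Cconst alpha by rewrite mulr_gt0//; lra.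
rewrite -powRrM mulNr mulVf; last by rewrite lt0r_neq0//; lra.
by rewrite powRN powRr1 ?(ltW aC0)// mulfV// lt0r_neq0.
Qed.

(** With u = C |y|^alpha the product is (1 + u)^2 - y^2, so the claim is y^2 <= 2u + u^2, which is
    [Cconst_amgm]. *)
Lemma catoni_expM_ge1 alpha (y : R) : 1 < alpha -> alpha < 2 ->
  1 <= catoni_exp alpha y * catoni_exp alpha (- y).
Proof.
move=> a1 a2; have := Cconst_amgm a1 a2 (normr_ge0 y).
rewrite real_normK ?num_real// /catoni_exp normrN.
set u := _ * _ `^ _ => H; nra.
Qed.

(** The product g(y) g(-y) is positive, so both factors have the same sign, and their sum is at
    least 2. *)
Lemma catoni_exp_gt0 alpha (y : R) : 1 < alpha -> alpha < 2 ->
  0 < catoni_exp alpha y.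
Proof.
move=> a1 a2; have := catoni_expM_ge1 y a1 a2; have C0 := Cconst_gt0 a1 a2.
have : 0 <= Cconst alpha * `|y| `^ alpha by rewrite mulr_ge0 ?powR_ge0// ltW.
rewrite /catoni_exp normrN; set u := _ * _ `^ _ => u0; nra.
Qed.

Lemma catoni_argmin_le0 alpha : catoni_argmin alpha <= 0.
Proof. by rewrite oppr_le0 powR_ge0. Qed.

(** For u < 0 the tangent inequality at |u| gives g(v) - g(u) >= (1 - alpha C |u|^(alpha - 1)) (v -
    u), whose slope is nonnegative to the right of the minimizer. For u >= 0 each term of g is
    monotone. *)
Lemma catoni_exp_homo alpha (u v : R) : 1 < alpha -> alpha < 2 ->
  catoni_argmin alpha <= u -> u <= v ->
  catoni_exp alpha u <= catoni_exp alpha v.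
Proof.
move=> a1 a2; have C0 := Cconst_gt0 a1 a2.
have ap0 : 0 < alpha - 1 by lra.
rewrite /catoni_exp /catoni_argmin; set ys := _ `^ (- _) => yu uv.
have [u0|u0] := leP 0 u.
  rewrite lerD ?lerD// ler_wpM2l ?(ltW C0)// ge0_ler_powR ?nnegrE//; first lra.
  by rewrite !ger0_norm// (le_trans u0).
have w0 : 0 <= - u by rewrite oppr_ge0 ltW.
have := powR_young v a1 w0.
have -> : `|u| = - u by rewrite ltr0_norm.
have ysE : alpha * Cconst alpha * ys `^ (alpha - 1) = 1.
  exact: catoni_argminE.
have : (- u) `^ (alpha - 1) <= ys `^ (alpha - 1).
  by rewrite ge0_ler_powR ?nnegrE ?powR_ge0// ?(ltW ap0)//; lra.
have -> : (- u) `^ alpha = (- u) * (- u) `^ (alpha - 1).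
  by rewrite mulr_powRB1//; lra.
set p := (- u) `^ _; set q := ys `^ _ in ysE *; set r := `|v| `^ _ => pq H.
have p0 : 0 <= p by rewrite powR_ge0.
have vv : - v <= `|v| by rewrite -normrN ler_norm.
have K1 : alpha * Cconst alpha * p <= 1.
  by rewrite -ysE ler_wpM2l// mulr_ge0; lra.
have K2 : alpha * p * (- v) <= alpha * p * `|v|.
  by rewrite ler_wpM2l// mulr_ge0//; lra.
have K3 : Cconst alpha * (alpha * p * (- v) - (alpha - 1) * (- u * p))
    <= Cconst alpha * r.
  by rewrite ler_wpM2l ?(ltW C0)//; lra.
have K4 : (1 - alpha * Cconst alpha * p) * (v - u) >= 0.
  by rewrite mulr_ge0; lra.
rewrite -subr_ge0 in K3; rewrite -subr_ge0 (le_trans (addr_ge0 K4 K3))//.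
by rewrite le_eqVlt; apply/predU1P; left; ring.
Qed.

(** The same tangent inequality, taken at the minimizer, where the slope vanishes. *)
Lemma catoni_exp_min alpha (v : R) : 1 < alpha -> alpha < 2 ->
  catoni_exp alpha (catoni_argmin alpha) <= catoni_exp alpha v.
Proof.
move=> a1 a2; have C0 := Cconst_gt0 a1 a2.
have ap0 : 0 < alpha - 1 by lra.
rewrite /catoni_exp /catoni_argmin; set ys := _ `^ (- _).
have ys0 : 0 <= ys by rewrite powR_ge0.
have ysE : alpha * Cconst alpha * ys `^ (alpha - 1) = 1.
  exact: catoni_argminE.
have := powR_young v a1 ys0.
rewrite normrN (ger0_norm ys0).
have -> : ys `^ alpha = ys * ys `^ (alpha - 1) by rewrite mulr_powRB1//; lra.
set q := ys `^ _ in ysE *; set r := `|v| `^ _ => H.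
have q0 : 0 <= q by rewrite powR_ge0.
have vv : - v <= `|v| by rewrite -normrN ler_norm.
have K2 : alpha * q * (- v) <= alpha * q * `|v|.
  by rewrite ler_wpM2l// mulr_ge0//; lra.
have K3 : Cconst alpha * (alpha * q * (- v) - (alpha - 1) * (ys * q))
    <= Cconst alpha * r.
  by rewrite ler_wpM2l ?(ltW C0)//; lra.
rewrite -subr_ge0 in K3; rewrite -subr_ge0 (le_trans K3)//.
have e : (1 - alpha * Cconst alpha * q) * (v + ys) = 0.
  by rewrite ysE subrr mul0r.
rewrite -[leLHS]addr0 -e.
by rewrite le_eqVlt; apply/predU1P; left; ring.
Qed.

Definition catoni_influence alpha (y : R) : R :=
  ln (catoni_exp alpha (Num.max y (catoni_argmin alpha))).

Lemma catoni_influence_homo alpha : 1 < alpha -> alpha < 2 ->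
  {homo catoni_influence alpha : x y / x <= y}.
Proof.
move=> a1 a2 x y xy; rewrite ler_ln ?posrE ?catoni_exp_gt0//.
apply: catoni_exp_homo => //; first by rewrite le_max lexx orbT.
by rewrite ge_max !le_max xy lexx orbT.
Qed.

Lemma expR_catoni_influence_le alpha (y : R) : 1 < alpha -> alpha < 2 ->
  expR (catoni_influence alpha y) <= catoni_exp alpha y.
Proof.
move=> a1 a2; rewrite lnK ?posrE ?catoni_exp_gt0//.
by have [|_] := leP y (catoni_argmin alpha); first rewrite catoni_exp_min.
Qed.

(** For the truncated argument z one has 1 / g(z) <= g(-z). If truncation occurs, then 0 <= -z <=
    -y, and g is increasing there, so g(-z) <= g(-y). *)
Lemma expRN_catoni_influence_le alpha (y : R) : 1 < alpha -> alpha < 2 ->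
  expR (- catoni_influence alpha y) <= catoni_exp alpha (- y).
Proof.
move=> a1 a2; rewrite expRN lnK ?posrE ?catoni_exp_gt0//.
set z := Num.max _ _.
rewrite -[X in X <= _]mul1r ler_pdivrMr ?catoni_exp_gt0// mulrC.
apply: (le_trans (catoni_expM_ge1 z a1 a2)).
rewrite ler_pM2l ?catoni_exp_gt0// /z.
have [h|_] := leP y (catoni_argmin alpha) => //.
apply: catoni_exp_homo => //; last by rewrite lerN2.
by rewrite (le_trans (catoni_argmin_le0 _))// oppr_ge0 catoni_argmin_le0.
Qed.

Lemma catoni_influence_bounds alpha (y : R) : 1 < alpha -> alpha < 2 ->
  - ln (catoni_exp alpha (- y)) <= catoni_influence alpha y
    <= ln (catoni_exp alpha y).
Proof.
move=> a1 a2; rewrite lerNl.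
rewrite -[X in (X <= _) && _]expRK -[X in _ && (X <= _)]expRK.
rewrite !ler_ln ?posrE ?expR_gt0 ?catoni_exp_gt0//.
by rewrite expR_catoni_influence_le ?expRN_catoni_influence_le.
Qed.

End catoni_bound.

(* The integrals of [moment_class] are taken over the default measurable
   structure of [R], those of [Msup] and [sup_log_mean_exp] over
   [measurableTypeR R]; both structures have the same measurable sets, but they
   are not convertible, so that one passes from one to the other by viewing the
   identity as a measurable function between them. *)
Section change_of_display.
Context {R : realType}.

Definition std_prob (P : borel_prob R) : set R -> \bar R := P.

HB.instance Definition _ (P : borel_prob R) :=
  isMeasure.Build _ R R (std_prob P) (measure0 P) (measure_ge0 P)
    (@measure_semi_sigma_additive _ _ _ P).

HB.instance Definition _ (P : borel_prob R) :=
  Measure_isProbability.Build _ R R (std_prob P) (@probability_setT _ _ _ P).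

Definition borel_of (P : probability R R) : set (measurableTypeR R) -> \bar R :=
  P.

HB.instance Definition _ (P : probability R R) :=
  isMeasure.Build _ (measurableTypeR R) R (borel_of P)
    (measure0 P) (measure_ge0 P) (@measure_semi_sigma_additive _ _ _ P).

HB.instance Definition _ (P : probability R R) :=
  Measure_isProbability.Build _ (measurableTypeR R) R (borel_of P)
    (@probability_setT _ _ _ P).

Definition has_moments (alpha sigma mu : R) (P : probability R R) :=
  [/\ P.-integrable [set: R] EFin,
      (\int[P]_x x%:E = mu%:E)%E
    & (\int[P]_x (`|x - mu| `^ alpha)%:E <= (sigma `^ alpha)%:E)%E].

Lemma moment_class_has_moments (alpha sigma mu : R) (P : borel_prob R) :
  moment_class alpha sigma mu P -> has_moments alpha sigma mu (std_prob P).
Proof. exact. Qed.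

Lemma has_moments_moment_class (alpha sigma mu : R) (P : probability R R) :
  has_moments alpha sigma mu P -> moment_class alpha sigma mu (borel_of P).
Proof. exact. Qed.

Lemma ge0_integral_std_prob (P : borel_prob R) (f : R -> \bar R) :
  measurable_fun [set: R] f -> (forall x, 0 <= f x)%E ->
  (\int[P]_x f x = \int[std_prob P]_x f x)%E.
Proof.
move=> mf f0; pose idR (x : R) : measurableTypeR R := x.
have mid : measurable_fun [set: R] idR by move=> _ A mA; rewrite setTI.
transitivity (\int[pushforward (std_prob P) idR]_x f x)%E => //.
by rewrite ge0_integral_pushforward// => x _; exact: f0.
Qed.

End change_of_display.

(** * Moments of order alpha over the centred class: finiteness, reflection, exponential bounds *)

Section moment_bounds.
Context {R : realType}.
Implicit Types (alpha sigma Delta c : R) (P : probability R R).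

Lemma measurable_dist_powR alpha c :
  measurable_fun [set: R] (fun x : R => `|x - c| `^ alpha).
Proof.
apply: (measurableT_comp (@measurable_powR R alpha)).
by apply: measurableT_comp => //; exact: measurable_funB.
Qed.

(** From |x - c| <= 2 max(|x|, |c|), the power of a maximum being at most the sum of the powers. *)
Lemma dist_powR_le alpha (x c : R) : 0 < alpha ->
  `|x - c| `^ alpha <= 2 `^ alpha * `|x| `^ alpha + (2 * `|c|) `^ alpha.
Proof.
move=> a0; rewrite -powRM ?normr_ge0//.
have xc : `|x - c| <= Num.max (2 * `|x|) (2 * `|c|).
  rewrite (le_trans (ler_normB _ _))// le_max.
  by have [|] := leP `|x| `|c|; lra.
rewrite (@le_trans _ _ (Num.max (2 * `|x|) (2 * `|c|) `^ alpha))//.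
  by rewrite ge0_ler_powR ?nnegrE ?(ltW a0)// le_max mulr_ge0.
by have [_|_] := leP (2 * `|x|) (2 * `|c|); rewrite ?lerDl ?lerDr powR_ge0.
Qed.

(** The bound is uniform over the class: it makes [Msup] finite and the shifted moments
    integrable. *)
Lemma moment_dist_le alpha sigma c P : 0 < alpha ->
  has_moments alpha sigma 0 P ->
  (\int[P]_x (`|x - c| `^ alpha)%:E <=
    (2 `^ alpha * sigma `^ alpha + (2 * `|c|) `^ alpha)%:E)%E.
Proof.
move=> a0 [_ _ Pm]; have mz := measurable_dist_powR alpha 0.
apply: (@le_trans _ _ (\int[P]_x
    ((2 `^ alpha)%:E * (`|x - 0| `^ alpha)%:E + ((2 * `|c|) `^ alpha)%:E))%E).
  apply: ge0_le_integral => //.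
  - by apply/measurable_EFinP; exact: measurable_dist_powR.
  - apply: emeasurable_funD => //; apply: measurable_funeM.
    by apply/measurable_EFinP.
  - by move=> x _; rewrite -EFinM -EFinD lee_fin subr0 dist_powR_le.
rewrite ge0_integralD//; last first.
  by apply: measurable_funeM; apply/measurable_EFinP.
have PT : P [set: R] = 1%E by exact: probability_setT.
rewrite integral_cst// EFinD [X in (_ * X)%E]PT mule1 leeD2r//.
rewrite ge0_integralZl_EFin ?powR_ge0//; last by apply/measurable_EFinP.
by rewrite EFinM lee_wpmul2l//; exact: Pm.
Qed.

(** A witness that the class is inhabited; it bounds [Msup] below by |Delta|^alpha, which makes the
    denominator of [rB] positive. *)
Lemma dirac0_has_moments alpha sigma : 0 < alpha ->
  has_moments alpha sigma 0 (\d_(0 : R) : probability R R).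
Proof.
move=> a0; have mid : measurable_fun [set: R] (EFin : R -> \bar R).
  by apply/measurable_EFinP.
split.
- apply/integrableP; split => //.
  by rewrite integral_dirac ?diracT ?mul1e ?abse0 ?normr0//;
    exact: measurableT_comp.
- by rewrite integral_dirac// diracT mul1e.
- rewrite integral_dirac//; last first.
    by apply/measurable_EFinP; exact: measurable_dist_powR.
  by rewrite diracT mul1e subrr normr0 powR0 ?lt0r_neq0// lee_fin powR_ge0.
Qed.

Lemma Msup_le alpha sigma Delta : 0 < alpha ->
  (Msup alpha sigma Delta <=
    (2 `^ alpha * sigma `^ alpha + (2 * `|Delta|) `^ alpha)%:E)%E.
Proof.
move=> a0; apply: ge_ereal_sup => _ [P /moment_class_has_moments PM <-].
rewrite ge0_integral_std_prob//; first exact: moment_dist_le.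
by apply/measurable_EFinP; exact: measurable_dist_powR.
Qed.

Lemma Msup_ub alpha sigma Delta P : has_moments alpha sigma 0 P ->
  (\int[P]_x (`|x - Delta| `^ alpha)%:E <= Msup alpha sigma Delta)%E.
Proof.
move=> PM; apply: ereal_sup_ubound; exists (borel_of P) => //=.
rewrite ge0_integral_std_prob//.
by apply/measurable_EFinP; exact: measurable_dist_powR.
Qed.

Lemma Msup_ge alpha sigma Delta : 0 < alpha ->
  ((`|Delta| `^ alpha)%:E <= Msup alpha sigma Delta)%E.
Proof.
move=> a0; have := Msup_ub Delta (dirac0_has_moments sigma a0).
rewrite integral_dirac//; last first.
  by apply/measurable_EFinP; exact: measurable_dist_powR.
by rewrite diracT mul1e sub0r normrN.
Qed.

Lemma Msup_fin_num alpha sigma Delta : 0 < alpha ->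
  Msup alpha sigma Delta \is a fin_num.
Proof.
move=> a0; rewrite ge0_fin_numE.
  exact: le_lt_trans (Msup_le sigma Delta a0) (ltry _).
by apply: le_trans (Msup_ge sigma Delta a0); rewrite lee_fin powR_ge0.
Qed.

Definition reflection (x : R) : R := - x.

Lemma measurable_reflection : measurable_fun [set: R] reflection.
Proof. exact: measurable_funN. Qed.

HB.instance Definition _ :=
  isMeasurableFun.Build _ _ R R reflection measurable_reflection.

Lemma integral_reflection_dist_powR alpha c P :
  (\int[distribution P reflection]_x (`|x - c| `^ alpha)%:E =
    \int[P]_x (`|x + c| `^ alpha)%:E)%E.
Proof.
have mf : measurable_fun [set: R] (fun x : R => (`|x - c| `^ alpha)%:E).
  by apply/measurable_EFinP; exact: measurable_dist_powR.
have f0 : {in [set: R], forall x : R, (0 <= (`|x - c| `^ alpha)%:E)%E}.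
  by move=> x _; rewrite lee_fin powR_ge0.
rewrite (ge0_integral_pushforward measurable_reflection P measurableT mf f0).
rewrite preimage_setT; apply: eq_integral => x _.
by rewrite /= /reflection -opprD normrN.
Qed.

(** The centred class is symmetric, so the supremum that controls E|X - Delta|^alpha controls E|X +
    Delta|^alpha as well. *)
Lemma has_moments_reflect alpha sigma P : has_moments alpha sigma 0 P ->
  has_moments alpha sigma 0 (distribution P reflection : probability R R).
Proof.
move=> [Pi Pz Pm]; have mid : measurable_fun [set: R] (EFin : R -> \bar R).
  by apply/measurable_EFinP.
have Ni : P.-integrable [set: R] (EFin \o reflection).
  by have := integrableN Pi; apply: eq_integrable.
split.
- exact: integrable_pushforward.
- rewrite integral_pushforward// preimage_setT.
  under eq_integral do rewrite /= /reflection -mulN1r EFinM.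
  by rewrite integralZl// [X in (_ * X)%E]Pz mule0.
- rewrite integral_reflection_dist_powR.
  by under eq_integral do rewrite addr0 -[X in `|X|]subr0.
Qed.

Lemma moment_distN_le_Msup alpha sigma Delta P : has_moments alpha sigma 0 P ->
  (\int[P]_x (`|x + Delta| `^ alpha)%:E <= Msup alpha sigma Delta)%E.
Proof.
move=> /has_moments_reflect /(Msup_ub Delta).
by rewrite integral_reflection_dist_powR.
Qed.

(** The linear term integrates to b times the mean, which is zero. *)
Lemma has_moments_integral_affine alpha sigma (a b k c : R) P : 0 < alpha ->
  has_moments alpha sigma 0 P ->
  (\int[P]_x (a + b * x + k * `|x - c| `^ alpha)%:E =
    a%:E + k%:E * \int[P]_x (`|x - c| `^ alpha)%:E)%E.
Proof.
move=> a0 PM; have [Pi Pz _] := PM.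
have Di : P.-integrable [set: R] (fun x : R => (`|x - c| `^ alpha)%:E).
  apply/integrableP; split.
    by apply/measurable_EFinP; exact: measurable_dist_powR.
  under eq_integral do rewrite gee0_abs ?lee_fin ?powR_ge0//.
  by rewrite (le_lt_trans (moment_dist_le c a0 PM))// ltry.
have ci : P.-integrable [set: R] (cst a%:E).
  exact: finite_measure_integrable_cst.
have bi : P.-integrable [set: R] (fun x : R => b%:E * x%:E)%E.
  exact: integrableZl.
have ki : P.-integrable [set: R] (fun x : R => k%:E * (`|x - c| `^ alpha)%:E)%E.
  exact: integrableZl.
under eq_integral do rewrite !EFinD !EFinM.
rewrite integralD//; last exact: integrableD.
rewrite integralD// !integralZl// Pz mule0 adde0 integral_cst//.
by rewrite [X in (_ * X)%E]probability_setT mule1.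
Qed.

(** A pointwise majorant of this shape reduces an exponential moment to a moment of order alpha. The
    slope b is arbitrary because it drops out on integration, so both signs of the test function are
    covered. *)
Lemma lne_integral_expR_le alpha sigma (f : R -> R) (a b k c r M : R) P :
  0 < alpha -> has_moments alpha sigma 0 P ->
  measurable_fun [set: R] f -> 0 <= k ->
  (forall x, expR (f x) <= a + b * x + k * `|x - c| `^ alpha) ->
  (\int[P]_x (`|x - c| `^ alpha)%:E <= M%:E)%E -> a + k * M <= expR r ->
  (lne (\int[P]_x (expR (f x))%:E) <= r%:E)%E.
Proof.
move=> a0 PM mf k0 fle cM Mr; rewrite -[leRHS]expeRK.
have intge0 : (0 <= \int[P]_x (expR (f x))%:E)%E.
  by apply: integral_ge0 => x _; rewrite lee_fin expR_ge0.
rewrite lee_lne ?in_itv/= ?intge0 ?leey ?lee_fin ?expR_ge0//.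
apply: (@le_trans _ _ (a%:E + k%:E * M%:E)%E); last first.
  by rewrite -EFinM -EFinD lee_fin.
apply: (@le_trans _ _
    (a%:E + k%:E * \int[P]_x (`|x - c| `^ alpha)%:E)%E); last first.
  by rewrite leeD2l// lee_wpmul2l// lee_fin.
rewrite -(@has_moments_integral_affine alpha sigma a b)//.
apply: ge0_le_integral => //.
- by apply/measurable_EFinP; exact: measurableT_comp.
- apply/measurable_EFinP; apply: measurable_funD.
    by apply: measurable_funD => //; exact: measurable_funM.
  by apply: measurable_funM => //; exact: measurable_dist_powR.
- by move=> x _; rewrite lee_fin.
Qed.

End moment_bounds.

(** * The monotone test function attaining the rate r_B *)

Section catoni_test_function.
Context {R : realType}.
Implicit Types (alpha sigma Delta : R).

Lemma sup_log_mean_exp_le alpha sigma (f : R -> R) (a b k c r M : R) :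
  0 < alpha -> measurable_fun [set: R] f -> 0 <= k ->
  (forall x, expR (f x) <= a + b * x + k * `|x - c| `^ alpha) ->
  (forall P : probability R R, has_moments alpha sigma 0 P ->
    \int[P]_x (`|x - c| `^ alpha)%:E <= M%:E)%E -> a + k * M <= expR r ->
  (sup_log_mean_exp alpha sigma f <= r%:E)%E.
Proof.
move=> a0 mf k0 fle cM Mr.
apply: ge_ereal_sup => _ [P /moment_class_has_moments PM <-].
rewrite ge0_integral_std_prob//; last first.
  by apply/measurable_EFinP; exact: measurableT_comp.
exact: (lne_integral_expR_le a0 PM mf k0 fle (cM _ PM) Mr).
Qed.

Lemma catoni_exp_scale alpha (h y : R) : 0 <= h ->
  catoni_exp alpha (y * h) =
    1 + y * h + Cconst alpha * h `^ alpha * `|y| `^ alpha.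
Proof.
by move=> h0; rewrite /catoni_exp normrM powRM// (ger0_norm h0); ring.
Qed.

Lemma catoni_test alpha sigma Delta : 1 < alpha -> alpha < 2 -> 0 < Delta ->
  exists (lambda : R) (psi : R -> R),
    [/\ 0 < lambda,
        {homo psi : x y / x <= y},
        forall x : R,
          - ln (1 - x / lambda + Cconst alpha * `|x / lambda| `^ alpha)
            <= psi x
            <= ln (1 + x / lambda + Cconst alpha * `|x / lambda| `^ alpha),
        (sup_log_mean_exp alpha sigma (fun x => psi (x - Delta)%R)
           <= (- rB alpha sigma Delta)%:E)%E
      & (sup_log_mean_exp alpha sigma (fun x => (- psi (x + Delta))%R)
           <= (- rB alpha sigma Delta)%:E)%E].
Proof.
move=> a1 a2 D0; have a0 : 0 < alpha by lra.
have ap0 : 0 < alpha - 1 by lra.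
have C0 := Cconst_gt0 a1 a2.
have Mfin := Msup_fin_num sigma Delta a0.
set M := fine (Msup alpha sigma Delta).
have M0 : 0 < M.
  rewrite -lte_fin fineK// (lt_le_trans _ (Msup_ge sigma Delta a0))//.
  by rewrite lte_fin powR_gt0// gtr0_norm.
have aCM0 : 0 < alpha * Cconst alpha * M by rewrite mulr_gt0// mulr_gt0.
(* [h] is 1 / lambda at the minimum of 1 - Delta h + C M h^alpha, the solution of Delta = alpha C M
   h^(alpha - 1). *)
pose h := (Delta / (alpha * Cconst alpha * M)) `^ (alpha - 1)^-1.
have h0 : 0 < h by rewrite powR_gt0// divr_gt0.
have hE : Cconst alpha * h `^ alpha * M = h * Delta / alpha.
  rewrite -(mulr_powRB1 (ltW h0) a0) -powRrM mulVf ?lt0r_neq0//.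
  rewrite powRr1 ?divr_ge0 ?ltW//.
  by field; rewrite !lt0r_neq0.
(* The powers of Delta match because q = 1 + 1 / (alpha - 1). *)
have rBE : rB alpha sigma Delta = (alpha - 1) / alpha * (Delta * h).
  rewrite /rB -/M /conj_exp; congr (_ * _).
  rewrite /h [in RHS]powRM ?invr_ge0 ?(ltW D0) ?(ltW aCM0)// mulrA.
  congr (_ * _); last first.
    rewrite -(powR_inv1 (ltW aCM0)) -(powR_inv1 (powR_ge0 _ _)).
    by rewrite powRAC.
  rewrite -[X in _ = X * _](powRr1 (ltW D0)) -powRD ?lt0r_neq0 ?implybT//.
  by congr powR; field; rewrite lt0r_neq0.
(* By [hE] the left side equals 1 - r_B exactly, and 1 + x <= exp x concludes. *)
have rBle : 1 - Delta * h + Cconst alpha * h `^ alpha * M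
    <= expR (- rB alpha sigma Delta).
  apply: le_trans (expR_ge1Dx _); rewrite hE rBE le_eqVlt; apply/predU1P; left.
  by field; rewrite lt0r_neq0.
have k0 : 0 <= Cconst alpha * h `^ alpha by rewrite mulr_ge0 ?powR_ge0// ltW.
have mpsi : measurable_fun [set: R]
    (fun x => catoni_influence alpha (x / h^-1)).
  apply: nondecreasing_measurable => // x y xy.
  by rewrite catoni_influence_homo// ler_pM2r// invrK.
exists h^-1, (fun x => catoni_influence alpha (x / h^-1)); split.
- by rewrite invr_gt0.
- by move=> x y xy; rewrite catoni_influence_homo// ler_pM2r// invrK.
- move=> x; have := catoni_influence_bounds (x / h^-1) a1 a2.
  by rewrite /catoni_exp normrN.
- apply: (@sup_log_mean_exp_le _ _ _ (1 - Delta * h) h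
    (Cconst alpha * h `^ alpha) Delta _ M) => //.
  + by apply: (measurableT_comp mpsi); exact: measurable_funB.
  + move=> x; rewrite (le_trans (expR_catoni_influence_le _ a1 a2))// invrK.
    rewrite catoni_exp_scale ?(ltW h0)// le_eqVlt.
    by apply/predU1P; left; ring.
  + by move=> P PM; rewrite fineK//; exact: Msup_ub.
(* The majorant is now g(-(x + Delta) h): slope and centre change sign, the constant term does not,
   and reflection gives the same [M]. *)
- apply: (@sup_log_mean_exp_le _ _ _ (1 - Delta * h) (- h)
    (Cconst alpha * h `^ alpha) (- Delta) _ M) => //.
  + apply: measurableT_comp => //.
    by apply: (measurableT_comp mpsi); exact: measurable_funD.
  + move=> x; rewrite (le_trans (expRN_catoni_influence_le _ a1 a2))// invrK.
    rewrite -mulNr catoni_exp_scale ?(ltW h0)// normrN opprK le_eqVlt.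
    by apply/predU1P; left; ring.
  + move=> P PM; rewrite fineK//.
    by under eq_integral do rewrite opprK; exact: moment_distN_le_Msup.
Qed.

Lemma rB_le_monotone_rate alpha sigma Delta :
  1 < alpha -> alpha < 2 -> 0 < Delta ->
  ((rB alpha sigma Delta)%:E <= monotone_rate alpha sigma Delta)%E.
Proof.
move=> a1 a2 D0.
have [l [psi [_ psi_homo _ le1 le2]]] := catoni_test sigma a1 a2 D0.
apply: ereal_sup_ubound; exists (rB alpha sigma Delta) => //; exists psi.
by split; [exact: psi_homo|
  rewrite (le_trans (leeD2r (rB alpha sigma Delta)%:E le1))|
  rewrite (le_trans (leeD2r (rB alpha sigma Delta)%:E le2))];
  rewrite -?EFinD ?addNr.
Qed.

End catoni_test_function.

(** * The mass at which the moment constraint binds, and the constant K *)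

Section binding_moment.
Context {R : realType}.
Implicit Types (alpha eps m : R).

Lemma powR_continuous (p x : R) : 0 < x -> {for x, continuous (@powR R ^~ p)}.
Proof.
move=> x0; apply/differentiable_continuous/derivable1_diffP.
by apply: derivable_powR; rewrite in_itv/= x0.
Qed.

Lemma s_star_sqr alpha : 1 < alpha -> alpha < 2 ->
  s_star alpha ^+ 2 = alpha * (2 - alpha).
Proof. by move=> a1 a2; rewrite sqr_sqrtr// mulr_ge0//; lra. Qed.

Lemma s_star_gt0 alpha : 1 < alpha -> alpha < 2 -> 0 < s_star alpha.
Proof. by move=> a1 a2; rewrite sqrtr_gt0 mulr_gt0//; lra. Qed.

(** Because 1 - s^2 = (alpha - 1)^2 > 0. *)
Lemma s_star_lt1 alpha : 1 < alpha -> alpha < 2 -> s_star alpha < 1.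
Proof.
move=> a1 a2; have := s_star_sqr a1 a2; have := s_star_gt0 a1 a2; nra.
Qed.

(* With [a = Delta / (2 s m)], the central moment of order [alpha] of the
   three-point law is [m a ^ alpha] times this quantity. *)
Definition moment_factor alpha m : R :=
  (1 - s_star alpha) * (1 + 2 * s_star alpha * m) `^ alpha
  + (1 + s_star alpha) * (1 - 2 * s_star alpha * m) `^ alpha
  + (1 - 2 * m) * ((2 * s_star alpha) `^ alpha * m `^ (alpha - 1)).

(** Crude bounds, obtained by comparing the powers of order alpha with 1 and with squares; here 2 s
    m <= 1/2. They serve to confine the rescaled mass to a fixed compact interval. *)
Lemma moment_factor_bounds alpha m : 1 < alpha -> alpha < 2 ->
  0 < m -> m <= 1 / 4 -> 1 / 2 <= moment_factor alpha m <= 9.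
Proof.
move=> a1 a2 m0 m4; have s0 := s_star_gt0 a1 a2; have s1 := s_star_lt1 a1 a2.
have a0 : 0 < alpha by lra.
rewrite /moment_factor; set s := s_star alpha in s0 s1 *.
have sm0 : 0 < s * m by rewrite mulr_gt0.
have sm4 : s * m <= 1 / 4 by nra.
have sqr2 (x : R) : 0 <= x -> x `^ 2 = x ^+ 2 by move=> x0; rewrite powR_mulrn.
have p1 (p : R) : 1 `^ p = 1 by rewrite powR1.
have A1 : 1 <= (1 + 2 * s * m) `^ alpha.
  by rewrite -[leLHS](p1 alpha) ge0_ler_powR ?nnegrE//; lra.
have A2 : (1 + 2 * s * m) `^ alpha <= 9 / 4.
  rewrite (@le_trans _ _ ((1 + 2 * s * m) `^ 2))//.
    by rewrite ler_powR; lra.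
  by rewrite sqr2; [nra|lra].
have B1 : 1 / 4 <= (1 - 2 * s * m) `^ alpha.
  rewrite (@le_trans _ _ ((1 - 2 * s * m) `^ 2))//.
    by rewrite sqr2; [nra|lra].
  by rewrite ger_powR; lra.
have B2 : (1 - 2 * s * m) `^ alpha <= 1.
  by rewrite -[leRHS](p1 alpha) ge0_ler_powR ?nnegrE//; lra.
have E1 : 0 <= (2 * s) `^ alpha * m `^ (alpha - 1).
  by rewrite mulr_ge0 ?powR_ge0.
have E2 : (2 * s) `^ alpha * m `^ (alpha - 1) <= 4.
  have D1 : (2 * s) `^ alpha <= 4.
    rewrite (@le_trans _ _ (2 `^ alpha))//.
      by rewrite ge0_ler_powR ?nnegrE//; lra.
    rewrite (@le_trans _ _ (2 `^ 2))//; first by rewrite ler_powR; lra.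
    by rewrite sqr2//; lra.
  have D2 : m `^ (alpha - 1) <= 1.
    by rewrite -[leRHS](p1 (alpha - 1)) ge0_ler_powR ?nnegrE//; lra.
  rewrite -[leRHS]mulr1 ler_pM ?powR_ge0//.
set u := powR _ _ in A1 A2 *; set v := powR _ _ in B1 B2 *.
set w := _ * _ `^ (alpha - 1) in E1 E2 *.
have F1 : 0 <= (1 - 2 * m) * w by rewrite mulr_ge0//; lra.
have F2 : (1 - 2 * m) * w <= w by rewrite ler_piMl//; lra.
by apply/andP; split; nra.
Qed.

Lemma moment_factor_continuous alpha m : 1 < alpha -> alpha < 2 ->
  0 < m -> m < 1 / 2 -> {for m, continuous (moment_factor alpha)}.
Proof.
move=> a1 a2 m0 m2; have s0 := s_star_gt0 a1 a2; have s1 := s_star_lt1 a1 a2.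
rewrite /moment_factor; set s := s_star alpha in s0 s1 *.
have sm : s * m < 1 / 2 by nra.
have sm0 : 0 < s * m by rewrite mulr_gt0.
have cl : (2 * s * x @[x --> m] --> 2 * s * m)%classic.
  by apply: cvgM; [exact: cvg_cst|exact: cvg_id].
apply: cvgD; first apply: cvgD.
- apply: cvgM; first exact: cvg_cst.
  apply: (@continuous_cvg _ _ _ _ _
    (fun x => 1 + 2 * s * x) (@powR R ^~ alpha)).
    by apply: powR_continuous; lra.
  by apply: cvgD => //; exact: cvg_cst.
- apply: cvgM; first exact: cvg_cst.
  apply: (@continuous_cvg _ _ _ _ _
    (fun x => 1 - 2 * s * x) (@powR R ^~ alpha)).
    by apply: powR_continuous; lra.
  by apply: cvgB => //; exact: cvg_cst.
- apply: cvgM.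
    apply: cvgB; first exact: cvg_cst.
    by apply: cvgM; [exact: cvg_cst|exact: cvg_id].
  by apply: cvgM; [exact: cvg_cst|exact: powR_continuous].
Qed.

(** The inverse of t -> (2s)^alpha t^(alpha - 1) on the nonnegative half-line. *)
Definition level alpha (c : R) : R :=
  (c / (2 * s_star alpha) `^ alpha) `^ (alpha - 1)^-1.

Lemma level_gt0 alpha (c : R) : 1 < alpha -> alpha < 2 -> 0 < c ->
  0 < level alpha c.
Proof.
move=> a1 a2 c0; have s0 := s_star_gt0 a1 a2.
by rewrite powR_gt0// divr_gt0// powR_gt0// mulr_gt0.
Qed.

Lemma levelK alpha (c : R) : 1 < alpha -> alpha < 2 -> 0 <= c ->
  (2 * s_star alpha) `^ alpha * level alpha c `^ (alpha - 1) = c.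
Proof.
move=> a1 a2 c0; have s0 := s_star_gt0 a1 a2.
have S0 : 0 < (2 * s_star alpha) `^ alpha by rewrite powR_gt0// mulr_gt0.
rewrite -powRrM mulVf; last by rewrite lt0r_neq0//; lra.
by rewrite powRr1 ?divr_ge0 ?(ltW S0)// mulrC divfK// lt0r_neq0.
Qed.

Lemma powRK_level alpha (t : R) : 1 < alpha -> alpha < 2 -> 0 <= t ->
  level alpha ((2 * s_star alpha) `^ alpha * t `^ (alpha - 1)) = t.
Proof.
move=> a1 a2 t0; have s0 := s_star_gt0 a1 a2.
have S0 : 0 < (2 * s_star alpha) `^ alpha by rewrite powR_gt0// mulr_gt0.
rewrite /level mulrC mulKf ?mulfK ?lt0r_neq0//.
by rewrite -powRrM mulfV ?powRr1// lt0r_neq0//; lra.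
Qed.

(** The interval for t = m / eps^q is the image under [level] of the bounds on [moment_factor]; it
    records that m has exact order eps^q. *)
Definition binding_mass alpha eps : set R := [set m |
  level alpha (1 / 2) <= m / eps `^ conj_exp alpha <= level alpha 9 /\
  moment_factor alpha m =
    (2 * s_star alpha) `^ alpha * (m / eps `^ conj_exp alpha) `^ (alpha - 1)].

Lemma binding_mass_nonempty alpha eps : 1 < alpha -> alpha < 2 -> 0 < eps ->
  level alpha 9 * eps `^ conj_exp alpha <= 1 / 4 ->
  exists m, binding_mass alpha eps m.
Proof.
move=> a1 a2 e0 e4; have s0 := s_star_gt0 a1 a2.
have ap0 : 0 < alpha - 1 by lra.
set E := eps `^ conj_exp alpha in e4 *.
have E0 : 0 < E by rewrite powR_gt0.
have S0 : 0 < (2 * s_star alpha) `^ alpha by rewrite powR_gt0// mulr_gt0.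
have l0 : 0 < level alpha (1 / 2) by apply: level_gt0 => //; lra.
have l12 : level alpha (1 / 2) <= level alpha 9.
  rewrite ge0_ler_powR ?nnegrE ?invr_ge0 ?(ltW ap0) ?divr_ge0 ?(ltW S0)//.
  by rewrite ler_pM2r ?invr_gt0//; lra.
(* At the two ends the power term equals 1/2 and 9, so the bounds on [moment_factor] make [H]
   nonpositive on the left and nonnegative on the right. *)
pose H (t : R) := (2 * s_star alpha) `^ alpha * t `^ (alpha - 1)
  - moment_factor alpha (t * E).
have bnd t : level alpha (1 / 2) <= t <= level alpha 9 ->
    0 < t * E /\ t * E <= 1 / 4.
  move=> /andP[h1 h2]; split; first by rewrite mulr_gt0// (lt_le_trans l0).
  by rewrite (le_trans _ e4)// ler_pM2r.
have [| |t] := @IVT R H (level alpha (1 / 2)) (level alpha 9) 0 l12.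
- apply: continuous_in_subspaceT => t; rewrite inE/= in_itv/= => tb.
  have [h1 h2] := bnd _ tb.
  have t0 : 0 < t by case/andP: tb => /(lt_le_trans l0).
  apply: cvgB.
    by apply: cvgM; [exact: cvg_cst|exact: powR_continuous].
  apply: (@continuous_cvg _ _ _ _ _ (fun x => x * E) (moment_factor alpha)).
    by apply: moment_factor_continuous => //; lra.
  by apply: cvgM; [exact: cvg_id|exact: cvg_cst].
- rewrite ge_min le_max; apply/andP; split; apply/orP; [left|right].
    rewrite /H levelK//.
    have [|h1 h2] := bnd (level alpha (1 / 2)); first by rewrite lexx.
    by have /andP[] := moment_factor_bounds a1 a2 h1 h2; lra.
  rewrite /H levelK//.
  have [|h1 h2] := bnd (level alpha 9); first by rewrite lexx andbT.
  by have /andP[] := moment_factor_bounds a1 a2 h1 h2; lra.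
rewrite in_itv/= => tb /eqP; rewrite subr_eq0 => /eqP Ht.
by exists (t * E); rewrite /binding_mass/= -/E mulfK ?lt0r_neq0.
Qed.

(** Solving the binding equation for t expresses m / eps^q through F(m) alone, so its limit follows
    from that of F(m). *)
Lemma binding_mass_level alpha eps m : 1 < alpha -> alpha < 2 -> 0 < eps ->
  binding_mass alpha eps m ->
  m = level alpha (moment_factor alpha m) * eps `^ conj_exp alpha.
Proof.
move=> a1 a2 e0 [/andP[h1 _] ->]; have l0 : 0 < level alpha (1 / 2).
  by apply: level_gt0 => //; lra.
move: h1 => /(lt_le_trans l0)/ltW t0; rewrite powRK_level//.
by rewrite divfK// lt0r_neq0// powR_gt0.
Qed.

(** The limit is (1 - s) + (1 + s). The power m^(alpha - 1) tends to its value at the boundary point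
    0, outside the scope of [powR_continuous], hence its own hypothesis. *)
Lemma moment_factor_cvg alpha (F : set_system R) {FF : Filter F} (m : R -> R) :
  1 < alpha -> alpha < 2 ->
  m x @[x --> F] --> (0 : R) ->
  m x `^ (alpha - 1) @[x --> F] --> (0 : R) ->
  moment_factor alpha (m x) @[x --> F] --> (2 : R).
Proof.
move=> a1 a2 m0 ma; rewrite /moment_factor.
set s := s_star alpha.
have e : (1 - s) * 1 `^ alpha + (1 + s) * 1 `^ alpha
   + (1 - 2 * 0) * ((2 * s) `^ alpha * 0) = 2 :> R by rewrite powR1; ring.
rewrite -[X in _ --> X]e.
have cl : (2 * s * m x @[x --> F] --> 2 * s * 0).
  by apply: cvgM => //; exact: cvg_cst.
apply: cvgD; first apply: cvgD.
- apply: cvgM; first exact: cvg_cst.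
  apply: (@continuous_cvg _ _ _ F FF
    (fun x => 1 + 2 * s * m x) (@powR R ^~ alpha) 1).
    exact: powR_continuous.
  by rewrite -[X in _ --> X]addr0 -(mulr0 (2 * s));
    apply: cvgD => //; exact: cvg_cst.
- apply: cvgM; first exact: cvg_cst.
  apply: (@continuous_cvg _ _ _ F FF
    (fun x => 1 - 2 * s * m x) (@powR R ^~ alpha) 1).
    exact: powR_continuous.
  by rewrite -[X in _ --> X]subr0 -(mulr0 (2 * s));
    apply: cvgB => //; exact: cvg_cst.
- apply: cvgM; last by apply: cvgM => //; exact: cvg_cst.
  apply: cvgB; first exact: cvg_cst.
  by apply: cvgM => //; exact: cvg_cst.
Qed.

(** This identifies K with the limit of 2 (2 - alpha) m / eps^q. Both sides are positive, and their
    logarithms are the same combination of ln 2, ln alpha, ln (alpha - 1) and ln (2 - alpha). *)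
Lemma KconstE alpha : 1 < alpha -> alpha < 2 ->
  Kconst alpha = 2 * (2 - alpha) * level alpha 2.
Proof.
move=> a1 a2; have a0 : 0 < alpha by lra.
have ap0 : 0 < alpha - 1 by lra.
have am0 : 0 < 2 - alpha by lra.
have s0 := s_star_gt0 a1 a2; have C0 := Cconst_gt0 a1 a2.
have l0 : 0 < level alpha 2 by exact: level_gt0.
have S0 : 0 < (2 * s_star alpha) `^ alpha by rewrite powR_gt0// mulr_gt0.
have X0 : 0 < (alpha * Cconst alpha) `^ (alpha - 1)^-1.
  by rewrite powR_gt0// mulr_gt0.
have K0 : 0 < Kconst alpha by rewrite divr_gt0// mulr_gt0.
apply: ln_inj; rewrite ?posrE//; first by rewrite !mulr_gt0.
have lns : ln (s_star alpha) = (ln alpha + ln (2 - alpha)) / 2.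
  have : ln (s_star alpha ^+ 2) = ln alpha + ln (2 - alpha).
    by rewrite s_star_sqr// lnM ?posrE.
  by rewrite lnXn// => <-; field.
have lnl : ln (level alpha 2) =
    (ln 2 - alpha * (ln 2 + ln (s_star alpha))) / (alpha - 1).
  rewrite ln_powR ln_div ?posrE// ln_powR lnM ?posrE//; exact: mulrC.
have lnX : ln ((alpha * Cconst alpha) `^ (alpha - 1)^-1) =
    (ln alpha + ln (Cconst alpha)) / (alpha - 1).
  by rewrite ln_powR lnM ?posrE// mulrC.
have aX0 : 0 < alpha * (alpha * Cconst alpha) `^ (alpha - 1)^-1.
  by rewrite mulr_gt0.
have -> : ln (Kconst alpha) = ln (alpha - 1)
    - (ln alpha + (ln alpha + ln (Cconst alpha)) / (alpha - 1)).
  by rewrite -lnX -lnM ?posrE// -ln_div ?posrE.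
have -> : ln (2 * (2 - alpha) * level alpha 2) =
    ln 2 + ln (2 - alpha) + ln (level alpha 2).
  by rewrite -lnM ?posrE// -lnM ?posrE// mulr_gt0.
rewrite lnl lns ln_Cconst//.
by field; rewrite lt0r_neq0.
Qed.

End binding_moment.

(** * Existence and integrals of three-point laws *)

Section three_point_law.
Context {R : realType}.

Lemma three_point_probability (pm p0 pp a : R) :
  0 <= pm -> 0 <= p0 -> 0 <= pp -> pm + p0 + pp = 1 ->
  exists P : probability R R, forall A : set R, P A = three_point pm p0 pp a A.
Proof.
move=> pm0 p00 pp0 p1.
pose d (x : R) : {measure set R -> \bar R} := \d_x.
pose mu : {measure set R -> \bar R} :=
  measure_add (measure_add
      (mscale (NngNum pm0) (d (- a))) (mscale (NngNum p00) (d 0)))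
    (mscale (NngNum pp0) (d a)).
have muE A : mu A = three_point pm p0 pp a A.
  by rewrite [LHS]measure_addE [X in (X + _)%E]measure_addE.
have muT : mu [set: R] = 1%E.
  by rewrite muE /three_point !diracT !mule1 -!EFinD p1.
pose mix := Measure_isProbability.Build _ R R mu muT.
pose P : probability R R := HB.pack (Measure.sort mu) mix.
by exists P.
Qed.

Section integral.
Variables (pm p0 pp a : R).
Hypotheses (pm0 : 0 <= pm) (p00 : 0 <= p0) (pp0 : 0 <= pp).
Variable P : probability R R.
Hypothesis PE : forall A : set R, P A = three_point pm p0 pp a A.

Lemma ge0_integral_three_point (f : R -> \bar R) :
  measurable_fun [set: R] f -> (forall x, 0 <= f x)%E ->
  (\int[P]_x f x = pm%:E * f (- a)%R + p0%:E * f 0%R + pp%:E * f a)%E.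
Proof.
move=> mf f0; pose d (x : R) : {measure set R -> \bar R} := \d_x.
rewrite (@eq_measure_integral _ _ _ _ (measure_add (measure_add
    (mscale (NngNum pm0) (d (- a))) (mscale (NngNum p00) (d 0)))
    (mscale (NngNum pp0) (d a)))); last first.
  move=> A mA _.
  by rewrite [RHS]measure_addE [X in _ = (X + _)%E]measure_addE; exact: PE.
rewrite !ge0_integral_measure_add// !ge0_integral_mscale//=.
by rewrite !integral_dirac// !diracT !mul1e.
Qed.

Lemma three_point_integral_EFin :
  P.-integrable [set: R] EFin /\
  (\int[P]_x x%:E = ((pp - pm) * a)%:E)%E.
Proof.
have mid : measurable_fun [set: R] (EFin : R -> \bar R).
  by apply/measurable_EFinP.
split.
  apply/integrableP; split => //.
  rewrite ge0_integral_three_point//; last exact: measurableT_comp.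
  by rewrite !abse_EFin -!EFinM -!EFinD ltry.
rewrite integralE !ge0_integral_three_point//; last 2 first.
- exact: measurable_funeneg.
- exact: measurable_funepos.
rewrite !funeposE !funenegE -!EFinN -!EFin_max -!EFinM -!EFinD.
congr EFin.
(* Relating the positive and negative parts this way avoids a case split on the sign of [a]. *)
have maxB (x : R) : Num.max x 0 = Num.max (- x) 0 + x.
  by rewrite addr_maxl addNr add0r maxC.
rewrite oppr0 opprK (maxB a); ring.
Qed.

Lemma three_point_dist_powR (alpha c : R) :
  (\int[P]_x (`|x - c| `^ alpha)%:E =
    (pm * `|- a - c| `^ alpha + p0 * `|c| `^ alpha
      + pp * `|a - c| `^ alpha)%:E)%E.
Proof.
rewrite ge0_integral_three_point//; last first.
  by apply/measurable_EFinP; exact: measurable_dist_powR.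
by rewrite -!EFinM -!EFinD sub0r normrN.
Qed.

End integral.

End three_point_law.

(** * A lower bound for the Hellinger affinity by common atoms *)

Section hellinger.
Context {R : realType}.
Local Open Scope charge_scope.
Local Notation T := (measurableTypeR R).

Lemma integral_set1_measure (mu : {measure set T -> \bar R}) (f : T -> \bar R)
  (r : T) : (\int[mu]_(x in [set r]) f x = f r * mu [set r])%E.
Proof.
have m1 : measurable ([set r] : set T) by exact: (@measurable_set1 R r).
rewrite -(integral_cst mu m1 (f r)); apply: eq_integral => x.
by rewrite inE/= => ->.
Qed.

Lemma sum_measureE (P Q : borel_prob R) (A : set T) :
  sum_measure P Q A = (P A + Q A)%E.
Proof. exact: measure_addE. Qed.

Lemma charge_dominated_sum (P Q : borel_prob R) :
  charge_of_finite_measure P `<< sum_measure P Q /\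
  charge_of_finite_measure Q `<< sum_measure P Q.
Proof.
have PQ0 A : measurable A -> sum_measure P Q A = 0%E -> P A = 0%E /\ Q A = 0%E.
  by move=> mA /eqP; rewrite sum_measureE padde_eq0// => /andP[/eqP -> /eqP ->].
by split; apply/null_content_dominatesP => A mA /(PQ0 _ mA)[].
Qed.

(** The density integrated over a singleton. The product form also covers points of zero mass. *)
Lemma Radon_Nikodym_atom (P Q mu : borel_prob R) (r : T) :
  (mu = P \/ mu = Q) ->
  ((fine ('d (charge_of_finite_measure mu) '/d (sum_measure P Q) r))%:E
     * sum_measure P Q [set r] = mu [set r])%E.
Proof.
move=> muPQ; have dom : charge_of_finite_measure mu `<< sum_measure P Q.
  by have [domP domQ] := charge_dominated_sum P Q; case: muPQ => ->.
have m1 : measurable ([set r] : set T) by exact: (@measurable_set1 R r).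
rewrite fineK ?Radon_Nikodym_fin_num//.
by rewrite -integral_set1_measure -Radon_Nikodym_integral.
Qed.

(** The integrand is nonnegative, so restricting it to finitely many points decreases the integral;
    [uniq] keeps the singletons disjoint. A point of mass m with densities u and v contributes m
    sqrt(uv) = sqrt(um vm). *)
Lemma hellinger_affinity_ge (P Q : borel_prob R) (s : seq R) : uniq s ->
  ((\sum_(x <- s) Num.sqrt (fine (P [set x]) * fine (Q [set x])))%:E
    <= hellinger_affinity P Q)%E.
Proof.
move=> us; have [domP domQ] := charge_dominated_sum P Q.
set f := fun x : T => (Num.sqrt
  (fine ('d (charge_of_finite_measure P) '/d (sum_measure P Q) x)
  * fine ('d (charge_of_finite_measure Q) '/d (sum_measure P Q) x)))%:E.
have mf : measurable_fun [set: T] f.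
  apply/measurable_EFinP; apply: measurableT_comp.
    by apply: continuous_measurable_fun; exact: sqrt_continuous.
  apply: measurable_funM; apply: measurableT_comp => //;
    exact: measurable_int (Radon_Nikodym_integrable _).
have f0 x : (0 <= f x)%E by rewrite lee_fin sqrtr_ge0.
have mset1 (r : R) : measurable ([set r] : set T).
  exact: (@measurable_set1 R r).
have set_consU (r : R) t : [set` r :: t] = [set r] `|` [set` t].
  by apply/seteqP; split => x /=; rewrite in_cons => /predU1P.
have mset (t : seq R) : measurable ([set` t] : set T).
  elim: t => [|r t IH]; first by rewrite set_nil.
  by rewrite set_consU; exact: measurableU.
have atomE x : (Num.sqrt (fine (P [set x]) * fine (Q [set x])))%:E =
    (\int[sum_measure P Q]_(y in [set x]) f y)%E.
  transitivity (f x * sum_measure P Q [set x])%E; last first.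
    by rewrite integral_set1_measure.
  have := Radon_Nikodym_atom x (or_introl (erefl P)) (Q := Q).
  have := Radon_Nikodym_atom x (or_intror (erefl Q)) (P := P).
  rewrite /f.
  set u := fine _; set v := fine _.
  have : sum_measure P Q [set x] \is a fin_num by rewrite fin_num_measure.
  have : (0 <= sum_measure P Q [set x])%E by [].
  case: (sum_measure P Q [set x]) => // m m0 _ <- <-.
  rewrite -!EFinM/=; congr EFin.
  rewrite lee_fin in m0.
  have -> : v * m * (u * m) = m ^+ 2 * (v * u) by ring.
  by rewrite sqrtrM ?sqr_ge0// sqrtr_sqr ger0_norm// mulrC.
suff -> : (\sum_(x <- s) Num.sqrt (fine (P [set x]) * fine (Q [set x])))%:E =
    (\int[sum_measure P Q]_(x in [set` s]) f x)%E.
  by apply: ge0_subset_integral.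
elim: s us => [_|r s IH /=/andP[rs us]].
  by rewrite big_nil set_nil integral_set0.
rewrite big_cons set_consU EFinD IH// atomE ge0_integral_setU//.
- exact: measurable_funTS.
- apply/disj_set2P; rewrite -subset0 => x [/= -> rs'].
  by move: rs; rewrite rs'.
Qed.

End hellinger.

(** * The extremal pair of three-point laws *)

Section extremal_pair.
Context {R : realType}.
Implicit Types (alpha sigma eps m a Delta : R).

(** The choice of s makes p_+ p_- = (1 - s^2) m^2 a perfect square, namely ((alpha - 1) m)^2. *)
Lemma star_affinityE alpha m : 1 < alpha -> alpha < 2 -> 0 <= m ->
  star_affinity alpha m = 1 - 2 * (2 - alpha) * m.
Proof.
move=> a1 a2 m0; rewrite /star_affinity /p_zero /p_plus /p_minus.
have -> : (1 + s_star alpha) * m * ((1 - s_star alpha) * m) =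
    (1 - s_star alpha ^+ 2) * m ^+ 2 by ring.
rewrite s_star_sqr//.
have -> : (1 - alpha * (2 - alpha)) * m ^+ 2 = ((alpha - 1) * m) ^+ 2 by ring.
rewrite sqrtr_sqr ger0_norm; first by ring.
by rewrite mulr_ge0//; lra.
Qed.

(** The signs of [a] and [Delta] are left free, so that both members of the pair are instances. *)
Lemma P_star_probability alpha sigma m a Delta :
  1 < alpha -> alpha < 2 -> 0 < m -> m < 1 / 2 ->
  (p_plus alpha m - p_minus alpha m) * a = Delta ->
  p_minus alpha m * `|- a - Delta| `^ alpha + p_zero m * `|Delta| `^ alpha
    + p_plus alpha m * `|a - Delta| `^ alpha = sigma `^ alpha ->
  exists P : borel_prob R,
    [/\ forall A : set (measurableTypeR R), P A = P_star_law alpha m a A,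
        (\int[P]_x (`|x - Delta| `^ alpha)%:E = (sigma `^ alpha)%:E)%E
      & moment_class alpha sigma Delta P].
Proof.
move=> a1 a2 m0 m2 mean mom; have s0 := s_star_gt0 a1 a2.
have s1 := s_star_lt1 a1 a2.
have pm0 : 0 <= p_minus alpha m by rewrite mulr_ge0//; lra.
have p00 : 0 <= p_zero m by rewrite /p_zero; lra.
have pp0 : 0 <= p_plus alpha m by rewrite mulr_ge0//; lra.
have p1 : p_minus alpha m + p_zero m + p_plus alpha m = 1.
  by rewrite /p_minus /p_zero /p_plus; ring.
have [P PE] := three_point_probability a pm0 p00 pp0 p1.
have [Pi Pmean] := three_point_integral_EFin pm0 p00 pp0 PE.
have Pmom := three_point_dist_powR pm0 p00 pp0 PE alpha Delta.
rewrite mom in Pmom; rewrite mean in Pmean.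
exists (borel_of P); split; [exact: PE| |].
  rewrite ge0_integral_std_prob//.
  by apply/measurable_EFinP; exact: measurable_dist_powR.
apply: has_moments_moment_class; split => //.
by rewrite [leLHS]Pmom.
Qed.

Lemma P_star_law_atoms alpha m a (P : borel_prob R) : a != 0 ->
  (forall A : set (measurableTypeR R), P A = P_star_law alpha m a A) ->
  [/\ P [set - a] = (p_minus alpha m)%:E, P [set 0 : R] = (p_zero m)%:E
    & P [set a] = (p_plus alpha m)%:E].
Proof.
move=> a0 PE; have aN : (a == - a) = false.
  by apply/negbTE; rewrite -subr_eq0 opprK -mulr2n mulrn_eq0.
have dE (x y : R) :
    \d_(x : measurableTypeR R) [set y] = ((x == y)%:R)%:E :> \bar R.
  have inE1 : (x \in ([set y] : set (measurableTypeR R))) = (x == y).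
    by apply/idP/eqP; rewrite inE.
  by rewrite diracE inE1.
rewrite !PE /P_star_law /three_point !dE !eqxx aN (eq_sym (- a) a) aN.
rewrite (eq_sym 0 (- a)) (eq_sym 0 a) oppr_eq0 (negbTE a0).
by rewrite /= !mule0 !mule1 !adde0 !add0e.
Qed.

(** Reflection exchanges the masses at a and -a: each of these atoms contributes sqrt(p_+ p_-), and
    the origin contributes p_0. *)
Lemma P_star_hellinger alpha m a (Pm Pp : borel_prob R) :
  1 < alpha -> alpha < 2 -> 0 < m -> m < 1 / 2 -> a != 0 ->
  (forall A : set (measurableTypeR R), Pm A = P_star_law alpha m (- a) A) ->
  (forall A : set (measurableTypeR R), Pp A = P_star_law alpha m a A) ->
  ((star_affinity alpha m)%:E <= hellinger_affinity Pm Pp)%E.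
Proof.
move=> a1 a2 m0 m2 a0 PmE PpE.
have aN : (- a == a) = false.
  by apply/negbTE; rewrite eq_sym -subr_eq0 opprK -mulr2n mulrn_eq0.
have us : uniq [:: - a; 0; a].
  by rewrite /= !inE aN oppr_eq0 (negbTE a0) eq_sym (negbTE a0).
apply: le_trans (hellinger_affinity_ge Pm Pp us).
have := @P_star_law_atoms alpha m (- a) Pm; rewrite oppr_eq0 opprK.
move=> /(_ a0 PmE)[e1 e2 e3]; have [f1 f2 f3] := P_star_law_atoms a0 PpE.
rewrite !big_cons big_nil e1 e2 e3 f1 f2 f3 /= lee_fin.
have p00 : 0 <= p_zero m by rewrite /p_zero; lra.
rewrite -expr2 sqrtr_sqr (ger0_norm p00) (mulrC (p_minus _ _)) /star_affinity.
by rewrite le_eqVlt; apply/predU1P; left; ring.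
Qed.

(** Since Delta = 2 s m a, all distances are multiples of a and the moment is a^alpha m F(m). The
    binding equation turns this into (2 s m a)^alpha / eps^alpha = (Delta / eps)^alpha. *)
Lemma binding_mass_moment alpha sigma eps m :
  1 < alpha -> alpha < 2 -> 0 < sigma -> 0 < eps -> 0 < m -> m < 1 / 2 ->
  binding_mass alpha eps m ->
  let Delta := eps * sigma in let a := atom alpha m Delta in
  p_minus alpha m * `|- a - Delta| `^ alpha + p_zero m * `|Delta| `^ alpha
    + p_plus alpha m * `|a - Delta| `^ alpha = sigma `^ alpha.
Proof.
move=> a1 a2 sg0 e0 m0 m2 [_ bm] Delta a; have s0 := s_star_gt0 a1 a2.
have s1 := s_star_lt1 a1 a2; have a0 : 0 < alpha by lra.
set s := s_star alpha in s0 s1 bm.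
have D0 : 0 < Delta by rewrite mulr_gt0.
have sm0 : 0 < s * m by rewrite mulr_gt0.
have sm2 : s * m < 1 / 2 by nra.
have d0 : 0 < 2 * s * m by rewrite -mulrA; lra.
have d1 : 2 * s * m < 1 by rewrite -mulrA; lra.
have aE : a = Delta / (2 * s * m).
  by rewrite /a /atom /p_plus /p_minus -/s; congr (_ / _); ring.
have ap : 0 < a by rewrite aE divr_gt0.
have DE : Delta = a * (2 * s * m).
  by rewrite aE divfK// lt0r_neq0.
have -> : `|- a - Delta| = a * (1 + 2 * s * m).
  by rewrite -opprD normrN gtr0_norm ?addr_gt0// {1}DE; ring.
have -> : `|Delta| = a * (2 * s) * m by rewrite gtr0_norm// DE; ring.
have -> : `|a - Delta| = a * (1 - 2 * s * m).
  have -> : a - Delta = a * (1 - 2 * s * m) by rewrite DE; ring.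
  by rewrite gtr0_norm// mulr_gt0// subr_gt0.
have ds0 : 0 < 2 * s by rewrite mulr_gt0.
have as0 : 0 < a * (2 * s) by rewrite mulr_gt0.
have up0 : 0 <= 1 + 2 * s * m by rewrite addr_ge0// ltW.
have um0 : 0 <= 1 - 2 * s * m by rewrite subr_ge0 ltW.
rewrite (powRM _ (ltW ap) up0) (powRM _ (ltW ap) um0).
rewrite (powRM _ (ltW as0) (ltW m0)) (powRM _ (ltW ap) (ltW ds0)).
rewrite -[X in _ + _ * (_ * X) + _](mulr_powRB1 (ltW m0) a0).
transitivity (a `^ alpha * (m * moment_factor alpha m)).
  by rewrite /moment_factor /p_minus /p_zero /p_plus -/s; ring.
have E0 : 0 < eps `^ conj_exp alpha by rewrite powR_gt0.
rewrite bm -/s.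
have Ei0 : 0 <= (eps `^ conj_exp alpha)^-1 by rewrite invr_ge0 ltW.
(* Here q (alpha - 1) = alpha. *)
have -> : (m / eps `^ conj_exp alpha) `^ (alpha - 1) =
    m `^ (alpha - 1) / eps `^ alpha.
  rewrite (powRM _ (ltW m0) Ei0) -(powR_inv1 (ltW E0)) -!powRrM -powRN.
  congr (_ * powR _ _); rewrite /conj_exp; field.
  by rewrite lt0r_neq0//; lra.
transitivity
  (a `^ alpha * (2 * s) `^ alpha * (m * m `^ (alpha - 1)) / eps `^ alpha).
  by ring.
rewrite mulr_powRB1 ?(ltW m0)// -(powRM _ (ltW ap) (ltW ds0)).
rewrite -(powRM _ (ltW as0) (ltW m0)) -mulrA -DE.
rewrite (powRM _ (ltW e0) (ltW sg0)) mulrAC divff ?mul1r// lt0r_neq0//.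
by rewrite powR_gt0.
Qed.

Lemma extremal_pair alpha sigma eps m :
  1 < alpha -> alpha < 2 -> 0 < sigma -> 0 < eps -> 0 < m -> m < 1 / 2 ->
  binding_mass alpha eps m ->
  let Delta := eps * sigma in let a := atom alpha m Delta in
  (exists Pp Pm : borel_prob R,
     [/\ forall A : set (measurableTypeR R), measurable A ->
           Pp A = P_star_law alpha m a A,
         forall A : set (measurableTypeR R), measurable A ->
           Pm A = P_star_law alpha m (- a) A,
         (\int[Pp]_x (`|x - Delta| `^ alpha)%:E = (sigma `^ alpha)%:E)%E,
         moment_class alpha sigma Delta Pp
       & moment_class alpha sigma (- Delta) Pm]) /\
  (hellinger_rate alpha sigma Delta <= (- ln (star_affinity alpha m))%:E)%E.
Proof.
move=> a1 a2 sg0 e0 m0 m2 bm Delta a; have s0 := s_star_gt0 a1 a2.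
have := binding_mass_moment a1 a2 sg0 e0 m0 m2 bm.
rewrite -/Delta -/a => mom.
have D0 : 0 < Delta by rewrite mulr_gt0.
have dp0 : 0 < p_plus alpha m - p_minus alpha m.
  rewrite (_ : _ - _ = 2 * s_star alpha * m).
    by rewrite mulr_gt0// mulr_gt0.
  by rewrite /p_plus /p_minus; ring.
have mean : (p_plus alpha m - p_minus alpha m) * a = Delta.
  by rewrite /a /atom mulrC divfK// lt0r_neq0.
have a0 : a != 0 by rewrite /a /atom mulf_neq0// ?invr_eq0 lt0r_neq0.
have [Pp [PpE Ppm Ppc]] := P_star_probability a1 a2 m0 m2 mean mom.
have meanN : (p_plus alpha m - p_minus alpha m) * (- a) = - Delta.
  by rewrite mulrN mean.
have momN : p_minus alpha m * `|- - a - - Delta| `^ alpha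
    + p_zero m * `|- Delta| `^ alpha
    + p_plus alpha m * `|- a - - Delta| `^ alpha = sigma `^ alpha.
  have -> : - - a - - Delta = - (- a - Delta) by ring.
  by rewrite [- a - - Delta](_ : _ = - (a - Delta)) ?normrN//; ring.
have [Pm [PmE _ Pmc]] := P_star_probability a1 a2 m0 m2 meanN momN.
split; first by exists Pp, Pm; split => // A _.
(* As 2 (2 - alpha) m < 1, the affinity is positive, where [lne] agrees with the real logarithm. *)
have A0 : 0 < star_affinity alpha m by rewrite star_affinityE ?(ltW m0)//; nra.
have Asup : ((star_affinity alpha m)%:E <=
    ereal_sup [set hellinger_affinity Pm Pp
              | Pm in moment_class alpha sigma (- Delta)
              & Pp in moment_class alpha sigma Delta])%E.
  apply: le_trans (P_star_hellinger a1 a2 m0 m2 a0 PmE PpE) _.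
  by apply: ereal_sup_ubound; exists Pm => //; exists Pp.
rewrite EFinN -lne_EFin// /hellinger_rate leeN2 lee_lne// in_itv/= leey andbT.
  by rewrite lee_fin ltW.
by rewrite (le_trans _ Asup)// lee_fin ltW.
Qed.

End extremal_pair.

(** * Expansions of the affinity and of the rate as eps tends to 0 *)

Section asymptotics.
Context {R : realType}.
Implicit Types (alpha eps m : R).

(** One solution is chosen for each eps; 0 is the default value where none exists, which
    [star_massP] excludes for small positive eps. *)
Definition star_mass alpha eps : R := xget 0 (binding_mass alpha eps).

Lemma conj_exp_gt0 alpha : 1 < alpha -> 0 < conj_exp alpha.
Proof. by move=> a1; rewrite divr_gt0//; lra. Qed.

Lemma star_massP alpha : 1 < alpha -> alpha < 2 ->
  \forall eps \near 0^'+, [/\ 0 < eps,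
    binding_mass alpha eps (star_mass alpha eps),
    0 < star_mass alpha eps <= level alpha 9 * eps `^ conj_exp alpha
    & star_mass alpha eps < 1 / 2].
Proof.
move=> a1 a2; have l0 : 0 < level alpha 9 by exact: level_gt0.
have l1 : 0 < level alpha (1 / 2) by apply: level_gt0 => //; lra.
have E0 := powR_cvg0 (conj_exp_gt0 a1).
near=> eps.
have e0 : 0 < eps by near: eps; exact: nbhs_right_gt.
have Ee0 : 0 < eps `^ conj_exp alpha by rewrite powR_gt0.
(* The threshold is the one at which the largest admissible mass equals 1/4. *)
have Ele : eps `^ conj_exp alpha <= (4 * level alpha 9)^-1.
  apply: le_trans (ler_norm _) _; near: eps; apply: (cvgr0_norm_le _ E0).
  by rewrite invr_gt0 mulr_gt0.
have e4 : level alpha 9 * eps `^ conj_exp alpha <= 1 / 4.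
  rewrite (le_trans (ler_wpM2l (ltW l0) Ele))// le_eqVlt; apply/predU1P; left.
  by field; rewrite lt0r_neq0.
have [m mP] := binding_mass_nonempty a1 a2 e0 e4.
have bm : binding_mass alpha eps (star_mass alpha eps).
  by apply: (@xgetPex _ 0); exists m.
have [/andP[m1 m2] _] := bm.
have mle : star_mass alpha eps <= level alpha 9 * eps `^ conj_exp alpha.
  by rewrite -ler_pdivrMr.
split => //.
  by rewrite mle andbT; have := lt_le_trans l1 m1; rewrite pmulr_lgt0 ?invr_gt0.
by rewrite (le_lt_trans mle)// (le_lt_trans e4)//; lra.
Unshelve. all: by end_near. Qed.

Lemma star_mass_cvg0 alpha : 1 < alpha -> alpha < 2 ->
  star_mass alpha eps @[eps --> 0^'+] --> (0 : R) /\
  star_mass alpha eps `^ (alpha - 1) @[eps --> 0^'+] --> (0 : R).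
Proof.
move=> a1 a2; have l0 : 0 < level alpha 9 by exact: level_gt0.
have E0 := powR_cvg0 (conj_exp_gt0 a1).
have a0 : 0 < alpha by lra.
have ap0 : 0 < alpha - 1 by lra.
split.
- apply: (@squeeze_cvgr _ _ _ _ (fun=> 0)
      (fun eps => level alpha 9 * eps `^ conj_exp alpha)).
  + near=> eps.
    by have /(_ _)[//|_ _ /andP[/ltW -> ->]] := near (star_massP a1 a2) eps.
  + exact: cvg_cst.
  + rewrite -[X in _ --> X](mulr0 (level alpha 9)).
    by apply: cvgM => //; exact: cvg_cst.
- apply: (@squeeze_cvgr _ _ _ _ (fun=> 0)
      (fun eps => level alpha 9 `^ (alpha - 1) * eps `^ alpha)).
  + near=> eps.
    have /(_ _)[//|e0 _ /andP[m0 mle] _] := near (star_massP a1 a2) eps.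
    rewrite powR_ge0/=.
    have -> : eps `^ alpha = (eps `^ conj_exp alpha) `^ (alpha - 1).
      by rewrite -powRrM divfK// lt0r_neq0.
    rewrite -powRM ?powR_ge0//.
    by rewrite ge0_ler_powR ?nnegrE ?(ltW ap0) ?(ltW m0)// mulr_ge0 ?powR_ge0.
  + exact: cvg_cst.
  + rewrite -[X in _ --> X](mulr0 (level alpha 9 `^ (alpha - 1))).
    by apply: cvgM; [exact: cvg_cst|apply: powR_cvg0].
Unshelve. all: by end_near. Qed.

(** For small eps this is (1 - affinity) / eps^q, with the mass rewritten through
    [binding_mass_level] so that its limit can be read off from F(m) -> 2. *)
Definition star_coef alpha eps : R :=
  2 * (2 - alpha) * level alpha (moment_factor alpha (star_mass alpha eps)).

Lemma star_coef_cvg alpha : 1 < alpha -> alpha < 2 ->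
  star_coef alpha eps @[eps --> 0^'+] --> Kconst alpha.
Proof.
move=> a1 a2; have [m0 ma] := star_mass_cvg0 a1 a2.
have s0 := s_star_gt0 a1 a2.
have S0 : 0 < (2 * s_star alpha) `^ alpha by rewrite powR_gt0// mulr_gt0.
have F2 := moment_factor_cvg a1 a2 m0 ma.
rewrite KconstE//; apply: cvgM; first exact: cvg_cst.
apply: (@continuous_cvg _ _ _ (at_right 0) _
  (fun eps => moment_factor alpha (star_mass alpha eps)
  / (2 * s_star alpha) `^ alpha) (@powR R ^~ (alpha - 1)^-1)).
  by apply: powR_continuous; rewrite divr_gt0.
by apply: cvgM; [exact: F2|exact: cvg_cst].
Qed.

Lemma star_affinity_coef alpha : 1 < alpha -> alpha < 2 ->
  \forall eps \near 0^'+, [/\ 0 < eps `^ conj_exp alpha,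
    0 <= star_coef alpha eps * eps `^ conj_exp alpha < 1
  & star_affinity alpha (star_mass alpha eps) =
     1 - star_coef alpha eps * eps `^ conj_exp alpha].
Proof.
move=> a1 a2; near=> eps.
have /(_ _)[//|e0 bm /andP[m0 _] m2] := near (star_massP a1 a2) eps.
have cE : star_coef alpha eps * eps `^ conj_exp alpha =
    2 * (2 - alpha) * star_mass alpha eps.
  by rewrite [in RHS](binding_mass_level a1 a2 e0 bm) mulrA.
rewrite cE; split; first by rewrite powR_gt0.
  by apply/andP; split; nra.
by rewrite star_affinityE// ltW.
Unshelve. all: by end_near. Qed.

Lemma star_affinity_littleo alpha : 1 < alpha -> alpha < 2 ->
  (fun eps : R => star_affinity alpha (star_mass alpha eps))
    = (fun eps : R => 1 - Kconst alpha * eps `^ conj_exp alpha)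
      +o_ (0^'+) (fun eps : R => eps `^ conj_exp alpha).
Proof.
move=> a1 a2; apply/eqaddoP => e e0; near=> eps.
have /(_ _)[//|E0 _ aE] := near (star_affinity_coef a1 a2) eps.
have -> : ((fun eps : R => star_affinity alpha (star_mass alpha eps))
   - (fun eps : R => 1 - Kconst alpha * eps `^ conj_exp alpha)) eps =
   (Kconst alpha - star_coef alpha eps) * eps `^ conj_exp alpha.
  by rewrite !fctE aE; ring.
rewrite normrM ler_wpM2r//; near: eps.
by move/cvgrPdist_le : (star_coef_cvg a1 a2); apply.
Unshelve. all: by end_near. Qed.

(** Both sides are ln (1 + x) <= x, at x = -u and at x = 1 / (1 - u) - 1. *)
Lemma opp_ln1B_bounds (u : R) : 0 <= u -> u < 1 ->
  u <= - ln (1 - u) <= u / (1 - u).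
Proof.
move=> u0 u1; have v0 : 0 < 1 - u by lra.
apply/andP; split.
  have := @le_ln1Dx R (- u); rewrite lerNr; apply; lra.
have -> : u / (1 - u) = (1 - u)^-1 - 1 by field; rewrite lt0r_neq0.
rewrite -lnV ?posrE//.
have := @le_ln1Dx R ((1 - u)^-1 - 1).
rewrite (_ : 1 + ((1 - u)^-1 - 1) = (1 - u)^-1); last by ring.
by apply; rewrite ltrBrDr addNr invr_gt0.
Qed.

(** With c = [star_coef], the rate divided by eps^q lies between c and c / (1 - c eps^q), and both
    tend to K. *)
Lemma star_rate_littleo alpha : 1 < alpha -> alpha < 2 ->
  (fun eps : R => - ln (star_affinity alpha (star_mass alpha eps)))
    = (fun eps : R => Kconst alpha * eps `^ conj_exp alpha)
      +o_ (0^'+) (fun eps : R => eps `^ conj_exp alpha).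
Proof.
move=> a1 a2; apply/eqaddoP => e e0.
pose E (eps : R) := eps `^ conj_exp alpha.
pose y (eps : R) := - ln (star_affinity alpha (star_mass alpha eps)).
have cE := star_coef_cvg a1 a2.
have E0 : E eps @[eps --> 0^'+] --> (0 : R) := powR_cvg0 (conj_exp_gt0 a1).
have yE : y eps / E eps @[eps --> 0^'+] --> Kconst alpha.
  apply: (@squeeze_cvgr _ _ _ _ (star_coef alpha)
    (fun eps => star_coef alpha eps / (1 - star_coef alpha eps * E eps))) => //.
    near=> eps.
    have /(_ _)[//|Ep /andP[u0 u1] aE] := near (star_affinity_coef a1 a2) eps.
    have /andP[h1 h2] := opp_ln1B_bounds u0 u1.
    rewrite /y aE ler_pdivlMr// h1/= ler_pdivrMr// (le_trans h2)//.
    by rewrite mulrAC.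
  have v1 : 1 - star_coef alpha eps * E eps @[eps --> 0^'+] --> (1 : R).
    have e1 : 1 - Kconst alpha * 0 = 1 by rewrite mulr0 subr0.
    rewrite -[X in _ --> X]e1.
    by apply: cvgB; [exact: cvg_cst|apply: cvgM; [exact: cE|exact: E0]].
  rewrite -[X in _ --> X]divr1; apply: cvgM; first exact: cE.
  by apply: cvgV => //; exact: oner_neq0.
near=> eps.
have Ep : 0 < E eps.
  by rewrite powR_gt0//; near: eps; exact: nbhs_right_gt.
have -> : ((fun eps : R => - ln (star_affinity alpha (star_mass alpha eps)))
   - (fun eps : R => Kconst alpha * eps `^ conj_exp alpha)) eps =
   - (Kconst alpha - y eps / E eps) * E eps.
  by rewrite mulNr mulrBl divfK ?lt0r_neq0// opprB.
rewrite normrM normrN ler_wpM2r//; near: eps.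
by move/cvgrPdist_le : yE; apply.
Unshelve. all: by end_near. Qed.

End asymptotics.

Unset Implicit Arguments.
Set Printing Implicit Defensive.
Set Strict Implicit.

Theorem proposition7 (R : realType) (sigma alpha : R) :
  0 < sigma -> 1 < alpha -> alpha < 2 ->
  (forall Delta : R, 0 < Delta ->
     [/\ Msup alpha sigma Delta \is a fin_num,
         exists (lambda : R) (psi : R -> R),
           [/\ 0 < lambda,
               {homo psi : x y / x <= y},
               forall x : R,
                 - ln (1 - x / lambda + Cconst alpha * `|x / lambda| `^ alpha)
                   <= psi x
                   <= ln (1 + x / lambda + Cconst alpha * `|x / lambda| `^ alpha),
               (sup_log_mean_exp alpha sigma (fun x => psi (x - Delta)%R)
                  <= (- rB alpha sigma Delta)%:E)%E
             & (sup_log_mean_exp alpha sigma (fun x => (- psi (x + Delta))%R)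
                  <= (- rB alpha sigma Delta)%:E)%E]
       & ((rB alpha sigma Delta)%:E <= monotone_rate alpha sigma Delta)%E])
  /\
  (exists m : R -> R,
     [/\ \forall eps \near 0^'+,
           let Delta := eps * sigma in
           let a := atom alpha (m eps) Delta in
           0 < m eps < 1 / 2 /\
           (exists Pp Pm : borel_prob R,
              [/\ forall A : set (measurableTypeR R), measurable A ->
                    Pp A = P_star_law alpha (m eps) a A,
                  forall A : set (measurableTypeR R), measurable A ->
                    Pm A = P_star_law alpha (m eps) (- a) A,
                  (\int[Pp]_x (`|x - Delta| `^ alpha)%:E
                     = (sigma `^ alpha)%:E)%E,
                  moment_class alpha sigma Delta Pp
                & moment_class alpha sigma (- Delta) Pm]) /\
           (hellinger_rate alpha sigma Delta
              <= (- ln (star_affinity alpha (m eps)))%:E)%E,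
         (fun eps : R => star_affinity alpha (m eps))
           = (fun eps : R => 1 - Kconst alpha * eps `^ conj_exp alpha)
             +o_ (0^'+) (fun eps : R => eps `^ conj_exp alpha)
       & (fun eps : R => - ln (star_affinity alpha (m eps)))
           = (fun eps : R => Kconst alpha * eps `^ conj_exp alpha)
             +o_ (0^'+) (fun eps : R => eps `^ conj_exp alpha)]).
Proof.
move=> sg0 a1 a2; split=> [Delta D0|].
  split; [|exact: catoni_test|exact: rB_le_monotone_rate].
  by apply: Msup_fin_num; lra.
exists (star_mass alpha); split; last exact: star_rate_littleo.
- apply: filterS (star_massP a1 a2) => eps [e0 bm /andP[m0 _] m2] /=.
  by split; [rewrite m0 m2|exact: extremal_pair].
- exact: star_affinity_littleo.
Qed.
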